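(* Let $n\ge1$ and let $W(n)=\{D_\pi:\pi\in S_n\}$. For $\pi,\sigma\in S_n$ with $m=\mathrm{minimal}(\pi,\sigma)$, $$M^{(W(n))}_{D_\pi,D_\sigma}(x)=x^m(1+x)^{n-m}\quad\text{and}\quad R^{(W(n))}_{D_\pi,D_\sigma}=\frac{(-1)^{m-1}}{n\binom{n-1}{m-1}}.$$ Consequently $R^{(W(n))}_{D_\pi,D_\pi}=1/n$, $\operatorname{tr}R^{(W(n))}=(n-1)!$, $M^{(W(n))}_{D_\pi,D_\pi}(x)=x(1+x)^{n-1}$, and $\operatorname{tr}M^{(W(n))}(x)=n!\,x(1+x)^{n-1}$.
   Context: A 4-tuple $(x,y,a,b)$ denotes an edge from peg $x$ at height $a$ to peg $y$ at height $b$ (height 1 is the bottom). For $\pi\in S_n$, $D_\pi=\{e_i=(\pi(i),n+1,1,i):1\le i\le n\}$, a web diagram on $n+1$ pegs; $W(n)$ is the web world of any $D_\pi$ (all diagrams obtained by permuting heights on each peg). Sum: $D\oplus D'=D\cup\{(x',y',a'+p_{x'}(D),b'+p_{y'}(D)):(x',y',a',b')\in D'\}$, with $p_i(D)$ the number of endpoints of $D$ on peg $i$. $\mathrm{rel}(X)$ relabels heights of endpoints of edges of $X$ on each peg by $1,\dots,\ell_i$ preserving relative order. An $\ell$-colouring of $D$ is a surjection from the edges onto $\{1,\dots,\ell\}$; with $D_c(t)$ the edges of colour $t$, $\mathcal{R}(D,c)=\mathrm{rel}(D_c(1))\oplus\cdots\oplus\mathrm{rel}(D_c(\ell))$. $f(D_1,D_2,\ell)$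 is the number of $\ell$-colourings $c$ of $D_1$ with $\mathcal{R}(D_1,c)=D_2$; $M^{(W)}_{D_1,D_2}(x)=\sum_{\ell\ge1}x^\ell f(D_1,D_2,\ell)$ and $R^{(W)}_{D_1,D_2}=\sum_{\ell\ge1}\frac{(-1)^{\ell-1}}{\ell}f(D_1,D_2,\ell)$. For $\pi,\sigma\in S_n$, $\mathrm{minimal}(\pi,\sigma)=1+|\{1\le j<n:\pi^{-1}(\sigma(j+1))<\pi^{-1}(\sigma(j))\}|$ (the number of left-to-right passes through $\pi$ needed to read $\sigma(1),\dots,\sigma(n)$ in order). *)

(* Defs.v *)
From mathcomp Require Export all_boot all_order all_fingroup all_algebra finmap.

Set Implicit Arguments.
Unset Strict Implicit.
Unset Printing Implicit Defensive.

Import GRing.Theory.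

Local Open Scope fset_scope.
Local Open Scope nat_scope.

(* An edge (x, y, a, b) joins peg x at height a to peg y at height b; pegs and
   heights are numbered from 1. *)
Notation edge := (nat * nat * nat * nat)%type.

Definition peg1 (e : edge) : nat := e.1.1.1.
Definition peg2 (e : edge) : nat := e.1.1.2.
Definition height1 (e : edge) : nat := e.1.2.
Definition height2 (e : edge) : nat := e.2.

Notation diagram := {fset edge}.

(* p_i(D) *)
Definition endpoints (D : diagram) (i : nat) : nat :=
  \sum_(e <- D) ((peg1 e == i) + (peg2 e == i)).

(* The common form of all the operations below: height h on peg x becomes
   t x h. *)
Definition map_heights (t : nat -> nat -> nat) (D : diagram) : diagram :=
  [fset ((peg1 e, peg2 e, t (peg1 e) (height1 e), t (peg2 e) (height2 e)) : edge)
     | e in D].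

(* D' is obtained from D by applying to the heights of each peg x a permutation
   t x of {1, ..., p_x(D)}, i.e. an injective map of this finite set to itself. *)
Definition in_web_world (D D' : diagram) : Prop :=
  exists2 t : nat -> nat -> nat,
    forall x : nat,
      {in [pred h | 0 < h <= endpoints D x] &, injective (t x)} /\
      {in [pred h | 0 < h <= endpoints D x],
         forall h, 0 < t x h <= endpoints D x}
    & D' = map_heights t D.

Definition web_sum (D D' : diagram) : diagram :=
  D `|` map_heights (fun x h => h + endpoints D x) D'.

(* The rank, starting from 1, of height h among the endpoints of X on peg x. *)
Definition height_rank (X : diagram) (x h : nat) : nat :=
  \sum_(e <- X) (((peg1 e == x) && (height1 e <= h)) +
                 ((peg2 e == x) && (height2 e <= h))).

Definition relabel (X : diagram) : diagram := map_heights (height_rank X) X.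

(* Colours are numbered from 0: colour t of 'I_l stands for t + 1. *)
Definition is_colouring (D : diagram) (l : nat) (c : {ffun D -> 'I_l}) : bool :=
  [forall t, exists e, c e == t].

Definition colour_class (D : diagram) (l : nat) (c : {ffun D -> 'I_l})
    (t : 'I_l) : diagram :=
  [fset val e | e : D & c e == t].

(* web_sum is associative on web diagrams and fset0 is its neutral element, so
   the bracketing chosen by \big is immaterial. *)
Definition recolour (D : diagram) (l : nat) (c : {ffun D -> 'I_l}) : diagram :=
  \big[web_sum/fset0]_(t < l) relabel (colour_class c t).

(* f(D1, D2, l) *)
Definition ncolourings (D1 D2 : diagram) (l : nat) : nat :=
  #|[set c : {ffun D1 -> 'I_l} | is_colouring c & recolour c == D2]|.

(* The sums over all l >= 1 below may be stopped at the number of edges. *)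
Lemma ncolourings_eq0 (D1 D2 : diagram) (l : nat) :
  #|` D1| < l -> ncolourings D1 D2 l = 0.
Proof.
move=> ltDl; apply/eqP; rewrite cards_eq0; apply/eqP/setP => c; rewrite !inE.
apply/negbTE/negP => /andP[/forallP sc _].
have inv t : exists e, c e = t by have /existsP[e /eqP] := sc t; exists e.
have sub : [set: 'I_l] \subset c @: [set: D1].
  by apply/subsetP => t _; have [e <-] := inv t; apply: imset_f; rewrite inE.
have := leq_trans (subset_leq_card sub) (leq_imset_card _ _).
by rewrite !cardsT card_ord -cardfE leqNgt ltDl.
Qed.

Local Open Scope ring_scope.

Definition M_entry (D1 D2 : diagram) : {poly int} :=
  \sum_(1 <= l < #|` D1|.+1) (ncolourings D1 D2 l)%:R *: 'X^l.

Definition R_entry (D1 D2 : diagram) : rat :=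
  \sum_(1 <= l < #|` D1|.+1) (-1) ^+ l.-1 / l%:R * (ncolourings D1 D2 l)%:R.

(* The matrix with rows and columns indexed by the diagrams of W, listed in the
   enumeration order of W. *)
Definition web_mx (T : Type) (W : {fset diagram}) (F : diagram -> diagram -> T) :
    'M[T]_#|` W| :=
  \matrix_(i, j) F (nth fset0 W i) (nth fset0 W j).

Definition M_mx (W : {fset diagram}) := web_mx W M_entry.
Definition R_mx (W : {fset diagram}) := web_mx W R_entry.

Local Open Scope nat_scope.

(* Indices and values of s are shifted by 1, 'I_n being {0, ..., n-1}. *)
Definition perm_diagram (n : nat) (s : 'S_n) : diagram :=
  [fset (((s i).+1, n.+1, 1, i.+1) : edge) | i : 'I_n].

Definition perm_world (n : nat) : {fset diagram} :=
  [fset perm_diagram s | s : 'S_n].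

(* ordS j is j + 1 when j + 1 < n. *)
Definition minimal (n : nat) (p s : 'S_n) : nat :=
  1 + #|[set j : 'I_n | j.+1 < n & (p^-1)%g (s (ordS j)) < (p^-1)%g (s j)]|.

(* Main.v *)
Require Import Defs.
From mathcomp Require Import ring.

Set Implicit Arguments.
Unset Strict Implicit.
Unset Printing Implicit Defensive.

Import Order.TTheory GRing.Theory Num.Theory.

Local Open Scope fset_scope.
Local Open Scope nat_scope.

(** Recolouring sorts the endpoints of each peg by (colour, height)
    lexicographically.  Hence a colouring [c] turns [perm_diagram p] into
    [perm_diagram s] iff the pairs (colour, height) increase when the edges are
    read along [q = s * p^-1] (apply [s], then [p^-1]), i.e. iff the colours
    read along [q] weakly increase, and strictly so at the descents of [q].  A
    weakly increasing surjection onto [l] colours is determined by its [l - 1]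
    rises among the [n - 1] gaps, and these must contain the [m - 1] descents:
    hence [f(D_p, D_s, l) = 'C(n - m, l - m)].  The sum for [R] is then the
    expansion of the Beta integral of [t^(m-1) (1 - t)^(n-m)]. *)

Lemma card_ord_lt (n k : nat) : k <= n -> #|[set j : 'I_n | j < k]| = k.
Proof.
move=> lekn; rewrite -sum1dep_card -[RHS]card_ord -sum1_card.
by rewrite (big_ord_widen _ (fun=> 1) lekn).
Qed.

Lemma ffun_precomp_bij (aT bT : finType) (rT : Type) (g : aT -> bT) :
  bijective g ->
  bijective (fun f : {ffun bT -> rT} => [ffun x => f (g x)] : {ffun aT -> rT}).
Proof.
case=> h gK hK; exists (fun f : {ffun aT -> rT} => [ffun y => f (h y)]) => f;
  by apply/ffunP => x; rewrite !ffunE ?gK ?hK.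
Qed.

Lemma intermediate_value_nat (f : nat -> nat) (N t : nat) :
    (forall k, k < N -> f k.+1 <= (f k).+1) -> f 0 <= t <= f N ->
  exists2 k, k <= N & f k = t.
Proof.
elim: N => [|N IHN] fS; first by rewrite -eqn_leq => /eqP; exists 0.
case/andP=> le0t letN; have [letfN|ltfNt] := leqP t (f N).
  have [k ltkN||k lekN <-] := IHN; last by exists k => //; apply: leqW.
    exact/fS/leqW.
  by rewrite le0t.
by exists N.+1 => //; apply/eqP; rewrite eqn_leq letN (leq_trans (fS N _)).
Qed.

Definition order_rank (disp : Order.disp_t) (T : orderType disp) (I : finType)
    (f : I -> T) (i : I) : nat :=
  #|[set j | (f j <= f i)%O]|.

Lemma order_rank_comp (disp : Order.disp_t) (T : orderType disp) (I : finType)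
    (f : I -> T) (g : I -> I) (i : I) :
  injective g -> order_rank (f \o g) i = order_rank f (g i).
Proof.
move=> injg; rewrite /order_rank -[RHS](card_preimset _ injg).
by apply: eq_card => j; rewrite !inE.
Qed.

Lemma order_rank_homo_ltP (disp : Order.disp_t) (T : orderType disp) (n : nat)
    (f : 'I_n -> T) :
    injective f ->
  (forall k, order_rank f k = k.+1) <-> {homo f : i j / i < j >-> (i < j)%O}.
Proof.
move=> injf; split=> [rankf i j lt_ij | incf k].
  rewrite ltNge; apply/negP => le_ji.
  suff: order_rank f j <= order_rank f i by rewrite !rankf ltnS leqNgt lt_ij.
  by apply/subset_leq_card/subsetP => l; rewrite !inE => /le_trans; apply.
rewrite -[RHS](@card_ord_lt n) //; apply: eq_card => j; rewrite !inE ltnS.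
have [/incf/ltW->|/incf|/val_inj->] := ltngtP j k; rewrite ?lexx //.
by rewrite leNgt => ->.
Qed.

Lemma homo_ord_lift (N : nat) (T : Type) (r : rel T) (f : 'I_N.+1 -> T) :
    transitive r ->
    (forall i : 'I_N, r (f (lift ord_max i)) (f (lift ord0 i))) ->
  {homo f : i j / i < j >-> r i j}.
Proof.
move=> r_tr rS i j lt_ij; rewrite -[i]inord_val -[j]inord_val.
apply: (@homo_ltn_in _ [pred k | k < N.+1] (f \o inord) r) => //.
- by move=> k m _ ltmN l /andP[_ /ltn_trans]; apply.
- move=> k ltkN1 ltkN; have := rS (Ordinal (ltkN : k < N)).
  by congr (is_true (r (f _) (f _))); apply: val_inj;
    rewrite [LHS](lift_max, lift0) [RHS]inordK.
- exact: ltn_ord.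
- exact: ltn_ord.
Qed.

Lemma lift_max_ltn_lift0 (N : nat) (i : 'I_N) : lift ord_max i < lift ord0 i.
Proof. by rewrite lift_max lift0. Qed.

Section RisesDescents.
Variables (disp : Order.disp_t) (T : orderType disp) (N : nat).
Implicit Types f : 'I_N.+1 -> T.

(* [lift ord_max i] and [lift ord0 i] are the positions [i] and [i + 1]. *)
Definition rises f : {set 'I_N} :=
  [set i | (f (lift ord_max i) < f (lift ord0 i))%O].

Definition descents f : {set 'I_N} :=
  [set i | (f (lift ord0 i) < f (lift ord_max i))%O].

Lemma descents_eq0P f :
  reflect (forall i : 'I_N, (f (lift ord_max i) <= f (lift ord0 i))%O)
          (descents f == set0).
Proof.
apply: (iffP eqP) => [/setP desf0 i|lef]; last first.
  by apply/setP => i; rewrite !inE ltNge lef.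
by have := desf0 i; rewrite !inE leNgt => ->.
Qed.

Lemma descents0_homo f :
  descents f = set0 -> {homo f : i j / i <= j >-> (i <= j)%O}.
Proof.
move/eqP/descents_eq0P => lef i j.
rewrite leq_eqVlt => /predU1P[/val_inj-> // | ].
exact: (homo_ord_lift le_trans).
Qed.

End RisesDescents.

Lemma lexi_homo_ltP (d1 d2 : Order.disp_t) (T1 : orderType d1)
    (T2 : orderType d2) (N : nat) (f : 'I_N.+1 -> T1) (g : 'I_N.+1 -> T2) :
    injective g ->
  {homo (fun k => (f k, g k) : T1 *l T2) : i j / i < j >-> (i < j)%O} <->
  descents f = set0 /\ descents g \subset rises f.
Proof.
move=> injg; have neqg (i : 'I_N) : g (lift ord_max i) != g (lift ord0 i).
  by rewrite (inj_eq injg) -val_eqE (ltn_eqF (lift_max_ltn_lift0 i)).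
split=> [incfg | [/eqP/descents_eq0P lef /subsetP desg]].
  have ltfg (i : 'I_N) := incfg _ _ (lift_max_ltn_lift0 i).
  split; [apply/eqP/descents_eq0P => i | apply/subsetP => i; rewrite !inE];
    have := ltfg i; rewrite ltxi_pair => /andP[] //.
  by move=> _; case: (leP (f _)) => //= _ /lt_gtF->.
apply: (homo_ord_lift lt_trans) => i; rewrite ltxi_pair lef /=.
apply/implyP => gef.
rewrite lt_neqAle neqg leNgt; apply: contraL gef => ltg.
by have := desg i; rewrite !inE -ltNge; apply.
Qed.

Section Staircases.
Variables N L : nat.
Implicit Types (T S : {set 'I_N}) (d : {ffun 'I_N.+1 -> 'I_L.+1}).

Definition staircase d : bool :=
  [forall t, exists k, d k == t] && (descents d == set0).

Definition card_below T (k : nat) : nat := #|[set i in T | i < k]|.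

Lemma card_below0 T : card_below T 0 = 0.
Proof. by apply: eq_card0 => i; rewrite !inE andbF. Qed.

Lemma card_below_all T : card_below T N = #|T|.
Proof. by apply: eq_card => i; rewrite inE ltn_ord andbT. Qed.

Lemma card_belowS T (i : 'I_N) : card_below T i.+1 = (i \in T) + card_below T i.
Proof.
rewrite /card_below (cardsD1 i) inE ltnSn andbT; congr (_ + _).
by apply: eq_card => j; rewrite !inE ltnS ltn_neqAle andbCA.
Qed.

Lemma card_below_le T (k : nat) : card_below T k <= #|T|.
Proof. by apply/subset_leq_card/subsetP => i; rewrite inE => /andP[]. Qed.

Lemma card_below_onto T t :
  t <= #|T| -> exists k : 'I_N.+1, card_below T k = t.
Proof.
move=> letT.
have [k ltkN||k lekN <-] := @intermediate_value_nat (card_below T) N t.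
- by rewrite (card_belowS T (Ordinal ltkN)); case: (_ \in _) => /=.
- by rewrite card_below0 card_below_all.
by exists (Ordinal (lekN : k < N.+1)).
Qed.

Lemma staircase_homo d : staircase d -> {homo d : i j / i <= j}.
Proof. by case/andP => _ /eqP/descents0_homo. Qed.

Lemma staircase_onto d t : staircase d -> exists k, d k = t.
Proof. by case/andP => /forallP/(_ t)/existsP[k /eqP]; exists k. Qed.

Lemma staircase_ord0 d : staircase d -> d ord0 = ord0.
Proof.
move=> std; have [k dk] := staircase_onto ord0 std.
by apply/eqP; rewrite -val_eqE -leqn0 -[0]/(val (@ord0 L)) -dk staircase_homo.
Qed.

Lemma staircase_ord_max d : staircase d -> d ord_max = ord_max.
Proof.
move=> std; have [k dk] := staircase_onto ord_max std.
apply/eqP; rewrite -val_eqE eqn_leq -ltnS ltn_ord -dk.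
by rewrite staircase_homo // -ltnS.
Qed.

Lemma staircase_lift d (i : 'I_N) : staircase d ->
  d (lift ord0 i) = (i \in rises d) + d (lift ord_max i) :> nat.
Proof.
move=> std; apply/eqP; rewrite inE ltEord eqn_leq.
case: ltnP => [ltd|->] /=; last by rewrite staircase_homo ?lift_max.
rewrite ltd andbT leqNgt; apply/negP => gap.
have [k dk] := staircase_onto (Ordinal (ltn_trans gap (ltn_ord _))) std.
have [leki|ltik] := leqP k (lift ord_max i).
  by have := staircase_homo std leki; rewrite dk ltnn.
have leik : lift ord0 i <= k by rewrite lift0 -(lift_max i).
by have := staircase_homo std leik; rewrite dk leqNgt gap.
Qed.

Lemma staircaseE d (k : 'I_N.+1) :
  staircase d -> d k = card_below (rises d) k :> nat.
Proof.
move=> std; case: k => k; elim: k => [|k IHk] ltkN.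
  rewrite card_below0 (_ : Ordinal _ = ord0) ?staircase_ord0 //.
  exact: val_inj.
have -> : Ordinal ltkN = lift ord0 (Ordinal (ltkN : k < N)) by apply: val_inj.
rewrite staircase_lift // card_belowS; congr (_ + _).
rewrite -(IHk (ltnW ltkN)); congr (val (d _)).
by apply: val_inj; apply: lift_max.
Qed.

Lemma card_rises_staircase d : staircase d -> #|rises d| = L.
Proof.
move=> std; rewrite -card_below_all -(staircaseE ord_max) //.
by rewrite staircase_ord_max.
Qed.

Definition staircase_of T : {ffun 'I_N.+1 -> 'I_L.+1} :=
  [ffun k : 'I_N.+1 => inord (card_below T k)].

Lemma staircase_ofE T (k : 'I_N.+1) :
  #|T| = L -> staircase_of T k = card_below T k :> nat.
Proof.
by move=> cardT; rewrite ffunE inordK // ltnS -cardT card_below_le.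
Qed.

Lemma staircase_of_lift T (i : 'I_N) : #|T| = L ->
  staircase_of T (lift ord0 i) =
  (i \in T) + staircase_of T (lift ord_max i) :> nat.
Proof.
by move=> cardT; rewrite !staircase_ofE // lift0 lift_max card_belowS.
Qed.

Lemma staircase_ofP T : #|T| = L -> staircase (staircase_of T).
Proof.
move=> cardT; apply/andP; split.
  apply/forallP => t; have [|k dk] := @card_below_onto T t.
    by rewrite cardT -ltnS.
  by apply/existsP; exists k; rewrite -val_eqE /= staircase_ofE ?dk.
by apply/descents_eq0P => i; rewrite leEord staircase_of_lift // leq_addl.
Qed.

Lemma rises_staircase_of T : #|T| = L -> rises (staircase_of T) = T.
Proof.
move=> cardT; apply/setP => i; rewrite inE ltEord staircase_of_lift //.
by case: (i \in T); rewrite ?ltnn // ltnSn.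
Qed.

Lemma card_staircases S :
  #|[set d | staircase d & S \subset rises d]| =
  #|[set T : {set 'I_N} | S \subset T & #|T| == L]|.
Proof.
rewrite -(card_in_imset (f := fun d => rises d)) => [|d d'].
  apply: eq_card => T; rewrite inE; apply/imsetP/andP => [[d]|[ST /eqP cardT]].
    by rewrite inE => /andP[std Sd] ->; rewrite card_rises_staircase.
  by exists (staircase_of T); rewrite ?inE rises_staircase_of ?staircase_ofP.
rewrite !inE => /andP[std _] /andP[std' _] eqr.
by apply/ffunP => k; apply: val_inj; rewrite /= !staircaseE ?eqr.
Qed.

End Staircases.

(* The first factor kills the case [k < #|S|], where truncated subtraction would
   give [1]. *)
Lemma card_supersets (T : finType) (S : {set T}) (k : nat) :
  #|[set U : {set T} | S \subset U & #|U| == k]| =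
  (#|S| <= k) * 'C(#|T| - #|S|, k - #|S|).
Proof.
have [leSk|ltkS] := leqP #|S| k; last first.
  apply/eqP; rewrite cards_eq0; apply/eqP/setP => U; rewrite !inE.
  apply/andP => -[/subset_leq_card + /eqP cardU].
  by rewrite cardU leqNgt ltkS.
have -> : #|T| - #|S| = #|~: S| by rewrite [in RHS]cardsCs setCK.
rewrite mul1n -cards_draws -[RHS](card_in_imset (f := setU S)) => [|A B].
  apply: eq_card => U; apply/idP/imsetP => [|[B]].
    rewrite inE => /andP[SU /eqP cardU]; exists (U :\: S).
      by rewrite inE subsetDr cardsD (setIidPr SU) cardU eqxx.
    by rewrite setDE setUIr setUCr setIT; apply/esym/setUidPr.
  rewrite !inE subsetC -disjoints_subset => /andP[disjSB /eqP cardB] ->.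
  by rewrite subsetUl cardsU disjoint_setI0 // cards0 subn0 cardB subnKC /=.
have setUK (C : {set T}) : C \subset ~: S -> (S :|: C) :\: S = C.
  rewrite -disjoints_subset => disjCS.
  by rewrite setDUl setDv set0U; apply/setDidPl.
rewrite !inE => /andP[/setUK AK _] /andP[/setUK BK _] eqU.
by rewrite -AK eqU BK.
Qed.

Lemma sum_bin_shift (V : nmodType) (n m : nat) (g : nat -> V) : 0 < m <= n ->
  (\sum_(1 <= l < n.+1) g l *+ ((m <= l) * 'C(n - m, l - m)) =
   \sum_(i < (n - m).+1) g (m + i) *+ 'C(n - m, i))%R.
Proof.
case/andP=> lt0m lemn.
rewrite (big_cat_nat lt0m) ?leqW //= big_nat big1 => [|l].
  rewrite add0r -[X in (\sum_(X <= _ < _) _)%R]add0n big_addn subSn //.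
  rewrite big_mkord.
  by apply: eq_bigr => i _; rewrite leq_addl addnK mul1n addnC.
by case/andP => _ ltlm; rewrite leqNgt ltlm.
Qed.

Section AlternatingBinomialSums.
Local Open Scope ring_scope.

Lemma sum_alt_binS (R : pzRingType) (f : nat -> R) (k : nat) :
  \sum_(i < k.+2) (-1) ^+ i * f i *+ 'C(k.+1, i) =
  \sum_(i < k.+1) (-1) ^+ i * f i *+ 'C(k, i) -
  \sum_(i < k.+1) (-1) ^+ i * f i.+1 *+ 'C(k, i).
Proof.
rewrite big_ord_recl bin0.
under eq_bigr => i _ do rewrite /= /bump /= add1n binS mulrnDr.
rewrite big_split /= addrA -sumrN; congr (_ + _).
  rewrite [RHS]big_ord_recl bin0 big_ord_recr /= bin_small // mulr0n addr0.
  by congr (_ + _); apply: eq_bigr => i _.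
by apply: eq_bigr => i _; rewrite exprS mulN1r mulNr mulNrn.
Qed.

(* Both sides are the integral of t^a (1 - t)^k over [0, 1]. *)
Lemma sum_alt_bin_inv (F : numFieldType) (a k : nat) :
  \sum_(i < k.+1) (-1) ^+ i / (a + i).+1%:R *+ 'C(k, i) =
  a`!%:R * k`!%:R / (a + k).+1`!%:R :> F.
Proof.
have fact_neq0 m : m`!%:R != 0 :> F by rewrite pnatr_eq0 -lt0n fact_gt0.
have succ_neq0 m : m.+1%:R != 0 :> F by rewrite pnatr_eq0.
elim: k a => [|k IHk] a.
  rewrite big_ord1 bin0 addn0 expr0 mulr1n mul1r fact0 mulr1 factS natrM invfM.
  by rewrite mulrCA mulfV ?mulr1.
rewrite (sum_alt_binS (fun i => (a + i).+1%:R^-1)) IHk.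
under eq_bigr => i _ do rewrite addnS -addSn.
rewrite IHk addSn addnS (factS a) (factS k) (factS (a + k).+1).
have := succ_neq0 (a + k).+1; have := fact_neq0 (a + k).+1.
have -> : (a + k).+2 = (a.+1 + k.+1)%N by rewrite addSn addnS.
move: (_.+1`!) => f; rewrite !natrM natrD.
by move: (a.+1%:R) (k.+1%:R) => x y f_neq0 xy_neq0; field; apply/andP.
Qed.

Lemma inv_bin_fact (F : numFieldType) (a k : nat) :
  ((a + k).+1%:R * 'C(a + k, a)%:R)^-1 =
  a`!%:R * k`!%:R / (a + k).+1`!%:R :> F.
Proof.
have natr_neq0 m : (0 < m)%N -> m%:R != 0 :> F by rewrite pnatr_eq0 -lt0n.
have := natr_neq0 _ (fact_gt0 a); have := natr_neq0 _ (fact_gt0 k).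
have := natr_neq0 _ (ltn0Sn (a + k)); have : 'C(a + k, a)%:R != 0 :> F.
  by rewrite natr_neq0 // bin_gt0 leq_addr.
rewrite factS -(bin_fact (leq_addr k a)) addKn !natrM.
move: (_.+1%:R) ('C(_, _)%:R) (a`!%:R) (k`!%:R) => x c y z.
by move=> c_neq0 x_neq0 z_neq0 y_neq0; field; apply/and4P.
Qed.

End AlternatingBinomialSums.

Lemma succ_ordP (n h : nat) : reflect (exists i : 'I_n, h = i.+1) (0 < h <= n).
Proof.
apply: (iffP idP) => [|[i ->]]; last exact: ltn_ord.
by case: h => // h lthn; exists (Ordinal (lthn : h < n)).
Qed.

Definition endpoint1 (e : edge) : nat * nat := (peg1 e, height1 e).

Definition map_edge (t : nat -> nat -> nat) (e : edge) : edge :=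
  (peg1 e, peg2 e, t (peg1 e) (height1 e), t (peg2 e) (height2 e)).

Lemma map_edge_id (t : nat -> nat -> nat) (e : edge) :
  (forall x h, t x h = h) -> map_edge t e = e.
Proof. by move=> tid; rewrite /map_edge !tid; case: e => [[[]]]. Qed.

Lemma mem_map_heights (t : nat -> nat -> nat) (D : diagram) (u : edge) :
  reflect (exists2 e, e \in D & u = map_edge t e) (u \in map_heights t D).
Proof. exact: imfsetP. Qed.

Lemma map_edge_in (t : nat -> nat -> nat) (D : diagram) (e : edge) :
  e \in D -> map_edge t e \in map_heights t D.
Proof. by move=> eD; apply/mem_map_heights; exists e. Qed.

Lemma sum_lt_lift0 (l : nat) (t : 'I_l) (f : 'I_l.+1 -> nat) :
  \sum_(v < l.+1 | v < lift ord0 t) f v =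
  f ord0 + \sum_(v < l | v < t) f (lift ord0 v).
Proof. by rewrite big_mkcond big_ord_recl /= -big_mkcond. Qed.

Lemma mem_big_web_sum (l : nat) (F : 'I_l -> diagram) (u : edge) :
  reflect (exists t, exists2 e, e \in F t &
             u = map_edge
                   (fun x h => h + \sum_(v < l | v < t) endpoints (F v) x) e)
          (u \in \big[web_sum/fset0]_(t < l) F t).
Proof.
elim: l F u => [|l IHl] F u; first by rewrite big_ord0 inE; constructor=> -[[]].
have shiftS (t : 'I_l) x h :
    h + \sum_(v < l.+1 | v < lift ord0 t) endpoints (F v) x =
    h + \sum_(v < l | v < t) endpoints (F (lift ord0 v)) x
      + endpoints (F ord0) x.
  by rewrite sum_lt_lift0 addnCA addnC.
have shift0 x h : h + \sum_(v < l.+1 | v < @ord0 l) endpoints (F v) x = h.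
  by rewrite big_pred0 ?addn0.
rewrite big_ord_recl; apply: (iffP idP).
  case/fsetUP => [uF0|/mem_map_heights[_ /IHl[t [e eF ->]] ->]].
    by exists ord0, u; rewrite ?map_edge_id.
  by exists (lift ord0 t), e; rewrite ?/map_edge ?shiftS.
case=> t [e eF ->]; apply/fsetUP; case: (unliftP ord0 t) eF => [t' ->|->] eF.
  right; apply/mem_map_heights; eexists; first by apply/IHl; exists t', e.
  by rewrite /map_edge !shiftS.
by left; rewrite map_edge_id.
Qed.

Lemma height_rank_ltn (X : diagram) (e : edge) (h : nat) :
    e \in X -> h < height1 e ->
  height_rank X (peg1 e) h < height_rank X (peg1 e) (height1 e).
Proof.
move=> eX lthe.
have mono (b : bool) y : (b && (y <= h)) <= (b && (y <= height1 e)).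
  by case: b (leqP y h) => -[] //= leyh; rewrite (leq_trans leyh (ltnW lthe)).
rewrite /height_rank !(big_fsetD1 e eX) /= eqxx leqnn (leqNgt (height1 e)) lthe.
rewrite -addSn leq_add //; first by rewrite /= add0n add1n ltnS.
by apply: leq_sum => e' _; apply: leq_add.
Qed.

Lemma endpoints_map_heights (t : nat -> nat -> nat) (D : diagram) (x : nat) :
  {in D &, injective (map_edge t)} ->
  endpoints (map_heights t D) x = endpoints D x.
Proof. by move=> injt; rewrite /endpoints big_imfset. Qed.

Lemma endpoints_relabel (X : diagram) (x : nat) :
  {in X &, injective endpoint1} -> endpoints (relabel X) x = endpoints X x.
Proof.
move=> injX; apply: endpoints_map_heights => e e' eX e'X [eq_peg _ eq_rank _].
apply: injX => //; rewrite -eq_peg in eq_rank; rewrite /endpoint1 -eq_peg.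
congr (_, _); case: (ltngtP (height1 e) (height1 e')) => //.
  by move/(height_rank_ltn e'X); rewrite -eq_peg eq_rank ltnn.
by move/(height_rank_ltn eX); rewrite eq_rank ltnn.
Qed.

Section Recolouring.
Variables (D : diagram) (l : nat) (c : {ffun D -> 'I_l}).

Lemma mem_colour_class (t : 'I_l) (u : edge) :
  reflect (exists2 e, c e = t & u = val e) (u \in colour_class c t).
Proof.
apply: (iffP (imfsetP _ _ _ _)) => -[e /=].
  by rewrite inE => /eqP; exists e.
by move=> ce ->; exists e; rewrite // inE ce.
Qed.

Lemma sum_colour_class (t : 'I_l) (G : edge -> nat) :
  \sum_(e <- colour_class c t) G e = \sum_(e | c e == t) G (val e).
Proof.
rewrite big_imfset /=; last by move=> e e' _ _; apply: val_inj.
by rewrite big_filter big_enum_cond.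
Qed.

Definition lexi_rank (t : 'I_l) (x h : nat) : nat :=
  \sum_(e : D)
    (((peg1 (val e) == x) &&
       (((c e, height1 (val e)) : 'I_l *l nat) <= (t, h))%O) +
     ((peg2 (val e) == x) &&
       (((c e, height2 (val e)) : 'I_l *l nat) <= (t, h))%O)).

Lemma lexi_rankE (t : 'I_l) (x h : nat) :
  lexi_rank t x h =
  height_rank (colour_class c t) x h +
  \sum_(v < l | v < t) endpoints (colour_class c v) x.
Proof.
rewrite /lexi_rank (partition_big c predT) //= (bigD1 t) //=; congr (_ + _).
  rewrite /height_rank sum_colour_class; apply: eq_bigr => e /eqP ->.
  by rewrite !lexi_pair lexx.
rewrite big_mkcond [RHS]big_mkcond; apply: eq_bigr => v _.
rewrite /endpoints sum_colour_class -val_eqE /=.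
case: (ltngtP v t) => // [ltvt|gtvt]; last first.
  apply: big1 => e /eqP ->.
  by rewrite !lexi_pair leEord leqNgt gtvt !andbF.
apply: eq_bigr => e /eqP ->.
by rewrite !lexi_pair leEord ltnW //= leqNgt ltvt !andbT.
Qed.

Lemma mem_recolour (u : edge) :
    {in D &, injective endpoint1} ->
  reflect (exists e : D, u = map_edge (lexi_rank (c e)) (val e))
          (u \in recolour c).
Proof.
move=> injD; have endpointsE v x :
    endpoints (relabel (colour_class c v)) x = endpoints (colour_class c v) x.
  apply: endpoints_relabel.
  move=> _ _ /mem_colour_class[e _ ->] /mem_colour_class[e' _ ->].
  by apply: injD; apply: valP.
have rankE (t : 'I_l) e :
    map_edge (fun x h =>
        h + \sum_(v < l | v < t) endpoints (relabel (colour_class c v)) x)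
      (map_edge (height_rank (colour_class c t)) e) = map_edge (lexi_rank t) e.
  by rewrite /map_edge !lexi_rankE /= !(eq_bigr _ (fun v _ => endpointsE v _)).
apply: (iffP (mem_big_web_sum _ _)) => [|[e ->]].
  case=> t [_ /mem_map_heights[_ /mem_colour_class[e <- ->] ->] ->].
  by exists e; rewrite rankE.
exists (c e), (map_edge (height_rank (colour_class c (c e))) (val e)).
  by apply/map_edge_in/mem_colour_class; exists e.
by rewrite rankE.
Qed.

End Recolouring.

Section PermDiagram.
Variable n : nat.
Implicit Types (p s : 'S_n) (i j k : 'I_n).

Definition perm_edge p i : edge := ((p i).+1, n.+1, 1, i.+1).

Lemma perm_edge_in p i : perm_edge p i \in perm_diagram p.
Proof. by apply/imfsetP; exists i. Qed.

Lemma perm_diagramP p (u : edge) :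
  reflect (exists i, u = perm_edge p i) (u \in perm_diagram p).
Proof. by apply: (iffP (imfsetP _ _ _ _)) => [[i _ ->]|[i ->]]; exists i. Qed.

Lemma perm_edge_inj p : injective (perm_edge p).
Proof. by move=> i j [_ /val_inj]. Qed.

Lemma card_perm_diagram p : #|` perm_diagram p| = n.
Proof.
rewrite card_imfset /=; last exact: perm_edge_inj.
by rewrite -cardE card_ord.
Qed.

Lemma perm_diagram_inj : injective (@perm_diagram n).
Proof.
move=> p s eqD; apply/permP => i; have := perm_edge_in p i.
rewrite eqD => /perm_diagramP[j [eq_peg /val_inj eq_ij]].
by rewrite [in RHS]eq_ij; apply: val_inj.
Qed.

Lemma perm_diagram_endpoint1_inj p : {in perm_diagram p &, injective endpoint1}.
Proof.
by move=> _ _ /perm_diagramP[i ->] /perm_diagramP[j ->] [/val_inj/perm_inj->].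
Qed.

Definition perm_edge_sub p i : perm_diagram p := [` perm_edge_in p i].

Lemma perm_edge_sub_bij p : bijective (perm_edge_sub p).
Proof.
apply: inj_card_bij => [i j /(congr1 val)/perm_edge_inj //|].
by rewrite -cardfE card_perm_diagram card_ord.
Qed.

Lemma sum_perm_edge_sub p (G : perm_diagram p -> nat) :
  \sum_e G e = \sum_i G (perm_edge_sub p i).
Proof.
by rewrite (reindex (perm_edge_sub p)) //; apply/onW_bij/perm_edge_sub_bij.
Qed.

Lemma sum_perm_diagram p (G : edge -> nat) :
  \sum_(e <- perm_diagram p) G e = \sum_i G (perm_edge p i).
Proof.
rewrite big_imfset /= => [|i j _ _]; last exact: perm_edge_inj.
by rewrite big_enum.
Qed.

Lemma eq_first_peg p i j : ((p i).+1 == (p j).+1) = (i == j).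
Proof. by rewrite eqSS val_eqE (inj_eq perm_inj). Qed.

Lemma eq_first_last_peg p i : ((p i).+1 == n.+1) = false.
Proof. by rewrite eqSS ltn_eqF. Qed.

Section RecolourPermDiagram.
Variables (p : 'S_n) (l : nat) (c : {ffun perm_diagram p -> 'I_l}).

Definition colour_height i : 'I_l *l 'I_n := (c (perm_edge_sub p i), i).

Lemma lexi_rank_first_peg i :
  lexi_rank c (c (perm_edge_sub p i)) (p i).+1 1 = 1.
Proof.
rewrite /lexi_rank sum_perm_edge_sub (bigD1 i) //= /peg1 /peg2 /= eqxx lexx.
rewrite eq_sym eq_first_last_peg big1 // => j neq_ji.
by rewrite eq_first_peg (negbTE neq_ji).
Qed.

Lemma lexi_rank_last_peg i :
  lexi_rank c (c (perm_edge_sub p i)) n.+1 i.+1 = order_rank colour_height i.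
Proof.
rewrite /lexi_rank sum_perm_edge_sub /order_rank -sum1dep_card.
rewrite [RHS]big_mkcond; apply: eq_bigr => j _ /=.
by rewrite /peg1 /peg2 /= eq_first_last_peg eqxx !lexi_pair /=; case: ifP.
Qed.

Lemma mem_recolour_perm_diagram (u : edge) :
  reflect (exists i, u = ((p i).+1, n.+1, 1, order_rank colour_height i))
          (u \in recolour c).
Proof.
have edgeE i :
    map_edge (lexi_rank c (c (perm_edge_sub p i))) (val (perm_edge_sub p i)) =
    ((p i).+1, n.+1, 1, order_rank colour_height i).
  by rewrite /map_edge lexi_rank_first_peg lexi_rank_last_peg.
apply: (iffP (mem_recolour _ _ (@perm_diagram_endpoint1_inj p))) => -[].
  have [edge_index _ edge_indexK] := perm_edge_sub_bij p.
  by move=> e ->; exists (edge_index e); rewrite -edgeE edge_indexK.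
by move=> i ->; exists (perm_edge_sub p i); rewrite edgeE.
Qed.

Lemma recolour_eq_perm_diagram s :
  recolour c = perm_diagram s <->
  {homo colour_height \o (s * p^-1)%g : i j / i < j >-> (i < j)%O}.
Proof.
set q := (s * p^-1)%g.
have inj_read : injective (colour_height \o q) by move=> i j [_ /perm_inj].
rewrite -(order_rank_homo_ltP inj_read); split=> [eqD k | rank_read].
  have := perm_edge_in s k; rewrite -eqD.
  case/mem_recolour_perm_diagram=> i [/val_inj sk rk].
  by rewrite order_rank_comp ?permM ?sk ?permK //; apply: perm_inj.
have edgeE k :
    ((p (q k)).+1, n.+1, 1, order_rank colour_height (q k)) = perm_edge s k.
  by rewrite -order_rank_comp ?rank_read ?permM ?permKV //; apply: perm_inj.
apply/fsetP => u; apply/mem_recolour_perm_diagram/perm_diagramP => -[i ->].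
  by exists ((q^-1)%g i); rewrite -edgeE permKV.
by exists (q i); rewrite edgeE.
Qed.

End RecolourPermDiagram.
End PermDiagram.

Lemma minimalE (N : nat) (p s : 'S_N.+1) :
  minimal p s = #|descents (s * p^-1)%g|.+1.
Proof.
rewrite /minimal add1n -(card_imset _ (@lift_inj N.+1 ord_max)); congr _.+1.
have ordS_lift (i : 'I_N) : ordS (lift ord_max i) = lift ord0 i.
  apply: ord_inj; rewrite lift0 -[in RHS](lift_max i).
  by apply: modn_small; rewrite ltnS lift_max.
apply: eq_card => j; rewrite !inE; apply/andP/imsetP => [[ltjN lt_sj]|[i + ->]].
  pose i := Ordinal (ltjN : j < N).
  have jE : j = lift ord_max i by apply: ord_inj; rewrite lift_max.
  by exists i; rewrite // inE ltEord !permM -ordS_lift -jE.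
rewrite inE ltEord !permM -ordS_lift => lt_sj; split=> //.
by rewrite ltnS lift_max.
Qed.

Lemma minimal_refl (n : nat) (p : 'S_n) : 0 < n -> minimal p p = 1.
Proof.
case: n p => // N p _; rewrite minimalE mulgV; apply/eqP.
rewrite eqSS cards_eq0; apply/descents_eq0P => i.
by rewrite !perm1 leEord ltnW ?lift_max_ltn_lift0.
Qed.

Lemma minimal_bounds (n : nat) (p s : 'S_n) : 0 < n -> 0 < minimal p s <= n.
Proof.
case: n p s => // N p s _; rewrite minimalE /= ltnS.
by rewrite (leq_trans (max_card _)) ?card_ord.
Qed.

Lemma ncolourings_staircases (N L : nat) (p s : 'S_N.+1) :
  ncolourings (perm_diagram p) (perm_diagram s) L.+1 =
  #|[set d : {ffun 'I_N.+1 -> 'I_L.+1} |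
      staircase d & descents (s * p^-1)%g \subset rises d]|.
Proof.
set q := (s * p^-1)%g.
have read_bij : bijective (perm_edge_sub p \o q).
  exact: bij_comp (perm_edge_sub_bij p) (injF_bij (@perm_inj _ q)).
rewrite -(on_card_preimset (onW_bij _ (ffun_precomp_bij 'I_L.+1 read_bij))).
apply: eq_card => c; rewrite !inE -andbA; congr (_ && _).
  have [position _ positionK] := read_bij.
  apply: eq_forallb => t; apply/existsP/existsP => -[e ce].
    by exists (position e); rewrite ffunE positionK.
  by exists ((perm_edge_sub p \o q) e); rewrite ffunE in ce.
set d := finfun _.
have readE k : (colour_height c \o q) k = (d k, q k) by rewrite ffunE.
apply/eqP/andP => [/recolour_eq_perm_diagram inc | [/eqP des0 sub]].
  have [|-> ->] := (lexi_homo_ltP d (@perm_inj _ q)).1 => //.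
  by move=> i j /inc; rewrite !readE.
apply/recolour_eq_perm_diagram => i j ltij; rewrite !readE.
exact: (lexi_homo_ltP d (@perm_inj _ q)).2.
Qed.

Lemma ncolourings_perm (n l : nat) (p s : 'S_n) : 0 < n -> 0 < l ->
  ncolourings (perm_diagram p) (perm_diagram s) l =
  (minimal p s <= l) * 'C(n - minimal p s, l - minimal p s).
Proof.
case: n p s => // N p s _; case: l => // L _.
rewrite ncolourings_staircases card_staircases card_supersets card_ord.
by rewrite minimalE.
Qed.

Lemma sum_ncolourings (V : nmodType) (n : nat) (p s : 'S_n) (g : nat -> V) :
    0 < n ->
  (\sum_(1 <= l < #|` perm_diagram p|.+1)
      g l *+ ncolourings (perm_diagram p) (perm_diagram s) l =
   \sum_(i < (n - minimal p s).+1)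
      g (minimal p s + i)%N *+ 'C(n - minimal p s, i))%R.
Proof.
move=> n_gt0; rewrite card_perm_diagram -sum_bin_shift ?minimal_bounds //.
by apply: eq_big_nat => l /andP[l_gt0 _]; rewrite ncolourings_perm.
Qed.

Section WebWorld.
Variable n : nat.
Implicit Types p s : 'S_n.

Lemma endpoints_first_peg p i : endpoints (perm_diagram p) (p i).+1 = 1.
Proof.
rewrite /endpoints sum_perm_diagram (bigD1 i) //= /peg1 /peg2 /= eqxx eq_sym.
rewrite eq_first_last_peg big1 // => j neq_ji.
by rewrite eq_first_peg (negbTE neq_ji).
Qed.

Lemma endpoints_last_peg p : endpoints (perm_diagram p) n.+1 = n.
Proof.
rewrite /endpoints sum_perm_diagram.
under eq_bigr => j _ do rewrite /peg1 /peg2 /= eq_first_last_peg eqxx.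
by rewrite sum1_card card_ord.
Qed.

Lemma map_heights_perm_diagram p (g : 'S_n) (t : nat -> nat -> nat) :
    (forall i, t (p i).+1 1 = 1) ->
    (forall i : 'I_n, t n.+1 i.+1 = (g i).+1) ->
  map_heights t (perm_diagram p) = perm_diagram (g^-1 * p)%g.
Proof.
move=> t_first t_last.
have edgeE i : map_edge t (perm_edge p i) = perm_edge (g^-1 * p)%g (g i).
  by rewrite /map_edge /perm_edge /= t_first t_last permM permK.
apply/fsetP => u; apply/mem_map_heights/perm_diagramP.
  by case=> _ /perm_diagramP[i ->] ->; exists (g i).
case=> i ->; exists (perm_edge p ((g^-1)%g i)); first exact: perm_edge_in.
by rewrite edgeE permKV.
Qed.

Lemma perm_world_of_web_world p (D : diagram) :
  in_web_world (perm_diagram p) D -> D \in perm_world n.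
Proof.
case=> t t_perm ->.
have t_first i : t (p i).+1 1 = 1.
  have [_ /(_ 1)] := t_perm (p i).+1.
  by rewrite endpoints_first_peg inE => /(_ isT); case: (t _ _) => [|[]].
have [] := t_perm n.+1; rewrite endpoints_last_peg => t_inj t_range.
have succ_in (i : 'I_n) : i.+1 \in [pred h | 0 < h <= n] by apply: ltn_ord.
have /fin_all_exists[g t_last] (i : 'I_n) : exists j : 'I_n, t n.+1 i.+1 = j.+1.
  exact/succ_ordP/t_range.
have g_inj : injective g.
  move=> i j eq_g; apply/val_inj/succn_inj/(t_inj _ _ (succ_in i) (succ_in j)).
  by rewrite !t_last eq_g.
apply/imfsetP; exists ((perm g_inj)^-1 * p)%g => //.
by apply: map_heights_perm_diagram => // i; rewrite permE.
Qed.

Lemma web_world_of_perm_world p (D : diagram) :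
  D \in perm_world n -> in_web_world (perm_diagram p) D.
Proof.
case/imfsetP => s _ ->; pose q := (p * s^-1)%g.
pose t x h := if x != n.+1 then h else oapp (fun i => (q i).+1) 0 (insub h.-1).
have t_last (i : 'I_n) : t n.+1 i.+1 = (q i).+1 by rewrite /t eqxx /= valK.
exists t => [x|]; last first.
  rewrite (@map_heights_perm_diagram p q t) // ?invMg ?invgK ?mulgKV // => i.
  by rewrite /t eq_first_last_peg.
have [->|neqx] := eqVneq x n.+1; last by rewrite /t neqx; split.
rewrite endpoints_last_peg.
split=> [h k /succ_ordP[i ->] /succ_ordP[j ->] | h /succ_ordP[i ->]].
  by rewrite !t_last => -[/val_inj/perm_inj->].
by rewrite t_last ltn_ord.
Qed.

Lemma card_perm_world : #|` perm_world n| = n`!.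
Proof.
rewrite card_imfset /=; last exact: perm_diagram_inj.
by rewrite -cardE -card_Sn; apply: eq_card.
Qed.

End WebWorld.

Local Open Scope ring_scope.

Lemma M_entry_perm (n : nat) (p s : 'S_n) : (0 < n)%N ->
  M_entry (perm_diagram p) (perm_diagram s) =
    'X^(minimal p s) * (1 + 'X) ^+ (n - minimal p s).
Proof.
move=> n_gt0; rewrite /M_entry; under eq_bigr => l _ do rewrite scaler_nat.
rewrite sum_ncolourings // exprDn mulr_sumr; apply: eq_bigr => i _.
by rewrite expr1n mul1r mulrnAr -exprD.
Qed.

Lemma R_entry_perm (n : nat) (p s : 'S_n) : (0 < n)%N ->
  R_entry (perm_diagram p) (perm_diagram s) =
    (-1) ^+ (minimal p s).-1 / (n%:R * 'C(n.-1, (minimal p s).-1)%:R).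
Proof.
move=> n_gt0; rewrite /R_entry; under eq_bigr => l _ do rewrite mulr_natr.
rewrite (sum_ncolourings p s (fun l => (-1) ^+ l.-1 / l%:R)) //.
move: (minimal p s) (minimal_bounds p s n_gt0) => {p s}.
case: n n_gt0 => // N _ [|a] //; rewrite subSS /= ltnS => leaN.
rewrite -[in RHS](subnKC leaN) inv_bin_fact.
rewrite -sum_alt_bin_inv mulr_sumr; apply: eq_bigr => i _.
by rewrite exprD -mulrA mulrnAr.
Qed.

Lemma trace_web_mx_const (T : nmodType) (W : {fset diagram})
    (F : diagram -> diagram -> T) (v : T) :
  {in W, forall D, F D D = v} -> \tr (web_mx W F) = v *+ #|` W|.
Proof.
move=> Fv; rewrite /mxtrace (eq_bigr (fun=> v)) => [|i _].
  by rewrite sumr_const card_ord.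
by rewrite mxE Fv // mem_nth.
Qed.

Lemma trace_perm_world (T : nmodType) (n : nat)
    (F : diagram -> diagram -> T) (v : T) :
  (forall p : 'S_n, F (perm_diagram p) (perm_diagram p) = v) ->
  \tr (web_mx (perm_world n) F) = v *+ n`!.
Proof.
move=> Fv; rewrite (trace_web_mx_const (v := v)) ?card_perm_world //.
by move=> _ /imfsetP[p _ ->].
Qed.

Theorem theorem6p8 (n : nat) (hn : (1 <= n)%N) :
  (forall (p : 'S_n) (D : diagram),
     in_web_world (perm_diagram p) D <-> D \in perm_world n) /\
  (forall p s : 'S_n,
     let m := minimal p s in
     M_entry (perm_diagram p) (perm_diagram s) = 'X^m * (1 + 'X) ^+ (n - m) /\
     R_entry (perm_diagram p) (perm_diagram s) =
       (-1) ^+ m.-1 / (n%:R * 'C(n.-1, m.-1)%:R)) /\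
  (forall p : 'S_n, R_entry (perm_diagram p) (perm_diagram p) = 1 / n%:R) /\
  \tr (R_mx (perm_world n)) = (n.-1)`!%:R /\
  (forall p : 'S_n,
     M_entry (perm_diagram p) (perm_diagram p) = 'X * (1 + 'X) ^+ n.-1) /\
  \tr (M_mx (perm_world n)) = n`!%:R * 'X * (1 + 'X) ^+ n.-1.
Proof.
have R_diag (p : 'S_n) : R_entry (perm_diagram p) (perm_diagram p) = 1 / n%:R.
  by rewrite R_entry_perm // minimal_refl //= bin0 mulr1 expr0.
have M_diag (p : 'S_n) :
    M_entry (perm_diagram p) (perm_diagram p) = 'X * (1 + 'X) ^+ n.-1.
  by rewrite M_entry_perm // minimal_refl // subn1.
do !split=> //.
- exact: perm_world_of_web_world.
- exact: web_world_of_perm_world.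
- exact: M_entry_perm.
- exact: R_entry_perm.
- rewrite (trace_perm_world R_diag) -[in n`!](prednK hn) factS prednK //.
  by rewrite mulrnA -[_ / _ *+ n]mulr_natr divfK // pnatr_eq0 -lt0n.
- by rewrite (trace_perm_world M_diag) -mulrA mulr_natl.
Qed.
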